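(* Let $\phi$ be a $t$-module of dimension $d$ over $\mathbb{C}_\infty$ with dual $t$-motive $N$, and let $s_1,\dots,s_d$ be the standard $\mathbb{C}_\infty[\sigma]$-basis of $N$. Suppose there exist a $\mathbb{C}_\infty[t]$-basis $e_1,\dots,e_r$ of $N$, integers $\ell_1,\dots,\ell_r\ge0$ with $\ell_1+\dots+\ell_r=d$, and an upper triangular matrix $C\in\mathrm{GL}_r(\mathbb{C}_\infty[t])$ such that: (1) with respect to $e_1,\dots,e_r$, the action of $\sigma$ is given by $\Phi=C\cdot\mathrm{diag}\big((t-\theta)^{\ell_1},\dots,(t-\theta)^{\ell_r}\big)$, i.e. $\sigma\big(\sum_ja_je_j\big)=\sum_jb_je_j$ where $(b_1,\dots,b_r)^\top=\Phi\,(a_1^{(-1)},\dots,a_r^{(-1)})^\top$; (2) $(t-\theta)^{j-1}e_i=s_{\ell_1+\dots+\ell_i-j+1}$ for all $1\le i\le r$ and $1\le j\le\ell_i$. Then every coefficient $P_i$ ($i\ge0$) of $\mathrm{Log}_\phi(\mathbf z)=\sum_{i\ge0}P_i\mathbf z^{(i)}$ is an invertible matrix.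
   Context: Let $A=\mathbb{F}_q[t]$, $K=\mathbb{F}_q(t)$, $K_\infty=\mathbb{F}_q((1/t))$, and let $\mathbb{C}_\infty$ be the completion of an algebraic closure of $K_\infty$; write $\theta\in\mathbb{C}_\infty$ for the image of $t$, so that $\mathbb{C}_\infty\otimes_{\mathbb{F}_q}A=\mathbb{C}_\infty[t]$ with $t$ an independent variable. For $f=\sum_j c_jt^j\in\mathbb{C}_\infty[t]$ and $i\in\mathbb{Z}$ put $f^{(i)}=\sum_jc_j^{q^i}t^j$; for $v\in\mathbb{C}_\infty^d$, $v^{(i)}$ raises entries to the $q^i$-th power. $\mathbb{C}_\infty[\tau]$ and $\mathbb{C}_\infty[\sigma]$ are skew polynomial rings with $\tau c=c^q\tau$, $\sigma c=c^{1/q}\sigma$. A $t$-module of dimension $d$ is an $\mathbb{F}_q$-algebra homomorphism $\phi:A\to\mathrm{Mat}_d(\mathbb{C}_\infty)[\tau]$ with $\phi_t=d[t]+\sum_{i\ge1}A_i\tau^i$ where $d[t]-\theta I_d$ is nilpotent; $\tau$ acts on $\mathbb{C}_\infty^d$ by raising entries to the $q$-th power. For $\beta=\sum_iB_i\tau^i$ put $\beta^*=\sum_i(B_i^\top)^{(-i)}\sigma^i$. The dual $t$-motive of $\phi$ is $N=\mathrm{Mat}_{1\times d}(\mathbb{C}_\infty[\sigma])$ with $t\cdot n=n\phi_t^*$, $c\cdot n=cn$ ($c\in\mathbb{C}_\infty$), $\sigma\cdot n=\sigma n$; it is assumed free of finite rank $r$ over $\mathbb{C}_\infty[t]$, with $(t-\theta)^nN\subseteq\sigma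 N$ for $n$ large. Its standard $\mathbb{C}_\infty[\sigma]$-basis $s_1,\dots,s_d$ consists of the standard basis row vectors. The logarithm $\mathrm{Log}_\phi(\mathbf z)=\sum_{i\ge0}P_i\mathbf z^{(i)}$ is the unique $\mathbb{F}_q$-linear power series with $P_i\in\mathrm{Mat}_d(\mathbb{C}_\infty)$, $P_0=I_d$, and $\mathrm{Log}_\phi(\phi_t(\mathbf z))=d[t]\,\mathrm{Log}_\phi(\mathbf z)$. *)

(* Defs.v *)
From HB Require Import structures.
From mathcomp Require Import all_boot all_order all_algebra all_fingroup.
From mathcomp Require Import all_solvable all_field.
From mathcomp Require Import reals zify.

Set Implicit Arguments.
Unset Strict Implicit.
Unset Printing Implicit Defensive.

Import Order.TTheory GRing.Theory Num.Theory.
Local Open Scope ring_scope.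

(* Skew polynomials over K: [skewpoly s] has the carrier {poly K}, the          *)
(* polynomial p standing for \sum_i p`_i T^i with coefficients on the left,     *)
(* and the product is determined by T c = s(c) T.                               *)
Definition skewpoly (K : fieldType) (s : {rmorphism K -> K}) : Type := {poly K}.

Section SkewPoly.

Variables (K : fieldType) (s : {rmorphism K -> K}).

Local Notation skewpoly := (skewpoly s).

HB.instance Definition _ := GRing.Zmodule.copy skewpoly {poly K}.

Implicit Types (p q r : {poly K}) (c : K).

Definition skew_mul p q : {poly K} :=
  \poly_(k < (size p + size q).-1) \sum_(j < k.+1) p`_j * iter j s q`_(k - j).

Let iter_sD j : {morph iter j s : x y / x + y}.
Proof. by elim: j => [|j IH] x y //; rewrite !iterS IH rmorphD. Qed.

Let iter_sM j : {morph iter j s : x y / x * y}.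
Proof. by elim: j => [|j IH] x y //; rewrite !iterS IH rmorphM. Qed.

Let iter_s0 j : iter j s 0 = 0.
Proof. by elim: j => //= j ->; rewrite rmorph0. Qed.

Let iter_s1 j : iter j s 1 = 1.
Proof. by elim: j => //= j ->; rewrite rmorph1. Qed.

Let iter_sum j I (t : seq I) (P : pred I) (F : I -> K) :
  iter j s (\sum_(i <- t | P i) F i) = \sum_(i <- t | P i) iter j s (F i).
Proof. exact: (big_morph _ (iter_sD j) (iter_s0 j)). Qed.

Lemma coef_skew_mul p q k :
  (skew_mul p q)`_k = \sum_(j < k.+1) p`_j * iter j s q`_(k - j).
Proof.
rewrite coef_poly ltn_predRL; case: leqP => // le_pq_k1.
rewrite big1 // => j _; have [le_p_j|lt_j_p] := leqP (size p) j.
  by rewrite nth_default ?mul0r.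
rewrite [q`__]nth_default ?iter_s0 ?mulr0 // leq_subRL -ltnS //.
by rewrite (leq_trans _ le_pq_k1) // ltn_add2r.
Qed.

Lemma coef_skew_mul_rev p q k :
  (skew_mul p q)`_k = \sum_(j < k.+1) p`_(k - j) * iter (k - j) s q`_j.
Proof.
rewrite coef_skew_mul (reindex_inj rev_ord_inj) /=.
by apply: eq_bigr => j _; rewrite (sub_ordK j).
Qed.

Lemma skew_mulA : associative skew_mul.
Proof.
move=> p q r; apply/polyP=> i; rewrite coef_skew_mul coef_skew_mul_rev.
pose coef3 j k := p`_j * (iter j s q`_(i - j - k) * iter (i - k) s r`_k).
transitivity (\sum_(j < i.+1) \sum_(k < i.+1 | (k <= i - j)%N) coef3 j k).
  apply: eq_bigr => /= j _; rewrite coef_skew_mul_rev iter_sum big_distrr /=.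
  rewrite (big_ord_narrow_leq (leq_subr _ _)); apply: eq_bigr => /= k _.
  rewrite iter_sM /coef3 -iterD; congr (_ * (_ * iter _ s _)).
  by have := ltn_ord k; have := ltn_ord j; lia.
rewrite (exchange_big_dep predT) //=; apply: eq_bigr => k _.
transitivity (\sum_(j < i.+1 | (j <= i - k)%N) coef3 j k).
  apply: eq_bigl => j; rewrite -ltnS -(ltnS j) -!subSn ?leq_ord //.
  by rewrite -subn_gt0 -(subn_gt0 j) -!subnDA addnC.
rewrite (big_ord_narrow_leq (leq_subr _ _)) coef_skew_mul big_distrl /=.
by apply: eq_bigr => j _; rewrite /coef3 -!subnDA addnC mulrA.
Qed.

Lemma skew_mul1p : left_id 1 skew_mul.
Proof.
move=> p; apply/polyP => i; rewrite coef_skew_mul big_ord_recl subn0.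
by rewrite big1 => [|j _]; rewrite coefC /= ?mul0r // addr0 mul1r.
Qed.

Lemma skew_mulp1 : right_id 1 skew_mul.
Proof.
move=> p; apply/polyP => i; rewrite coef_skew_mul_rev big_ord_recl subn0.
by rewrite big1 => [|j _]; rewrite coefC /= ?iter_s0 ?mulr0 // iter_s1 addr0 mulr1.
Qed.

Lemma skew_mulDl : left_distributive skew_mul +%R.
Proof.
move=> p q r; apply/polyP=> i; rewrite coefD !coef_skew_mul -big_split.
by apply: eq_bigr => j _; rewrite coefD mulrDl.
Qed.

Lemma skew_mulDr : right_distributive skew_mul +%R.
Proof.
move=> p q r; apply/polyP=> i; rewrite coefD !coef_skew_mul -big_split.
by apply: eq_bigr => j _; rewrite coefD iter_sD mulrDr.
Qed.

HB.instance Definition _ := GRing.Zmodule_isNzRing.Build skewpoly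
  skew_mulA skew_mul1p skew_mulp1 skew_mulDl skew_mulDr (oner_neq0 {poly K}).

Definition skewC c : skewpoly := c%:P.
Definition skewX : skewpoly := 'X.
Definition skew_coef (p : skewpoly) (k : nat) : K := (p : {poly K})`_k.

Lemma skewCM : {morph skewC : a b / a * b}.
Proof.
move=> a b; apply/polyP => k; rewrite [RHS]coef_skew_mul big_ord_recl subn0.
rewrite big1 => [|j _]; rewrite !coefC /= ?mul0r // addr0.
by case: (k == 0)%N; rewrite ?mulr0.
Qed.

Lemma skewXC c : skewX * skewC c = skewC (s c) * skewX.
Proof.
apply/polyP => k; rewrite [LHS]coef_skew_mul [RHS]coef_skew_mul.
case: k => [|k].
  by rewrite !big_ord1 /= /skewX !coefX mul0r mulr0.
rewrite [LHS]big_ord_recl [RHS]big_ord_recl /= /skewX coefX mul0r add0r.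
rewrite [in RHS]big1 => [|i _]; last by rewrite coefC mul0r.
rewrite big_ord_recl [in LHS]big1 => [|i _]; last by rewrite coefX mul0r.
rewrite !addr0 !coefC !coefX /= mul1r /bump /= subn1 /= eqSS.
by case: (k == 0)%N; rewrite ?mulr1 ?mulr0 ?rmorph0.
Qed.

End SkewPoly.

Section Valued.

Variables (Fq : finFieldType) (R : realType) (C : fieldType).
Variables (iota : {rmorphism Fq -> C}) (theta : C) (abs : C -> R).

Definition cvg_abs (u : nat -> C) (l : C) : Prop :=
  forall e : R, 0 < e -> exists N, forall m, (N <= m)%N -> abs (u m - l) < e.

Definition cauchy_abs (u : nat -> C) : Prop :=
  forall e : R, 0 < e ->
    exists N, forall m k, (N <= m)%N -> (N <= k)%N -> abs (u m - u k) < e.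

(* The image of F_q((1/t)) under t |-> theta: limits of the partial sums of     *)
(* \sum_(i >= 0) a_i theta^(n - i).                                             *)
Definition Kinf (x : C) : Prop :=
  exists (n : nat) (a : nat -> Fq),
    cvg_abs (fun m => \sum_(i < m) iota (a i) * (theta ^+ n / theta ^+ i)) x.

Definition algebraic_Kinf (x : C) : Prop :=
  exists p : {poly C}, [/\ p != 0, forall i, Kinf p`_i & root p x].

End Valued.

(* C_oo, as a completion of an algebraic closure of F_q((1/t)): a complete      *)
(* algebraically closed valued field in which the algebraic closure of Kinf is  *)
(* dense. These conditions determine it up to isomorphism.                      *)
Record Cinfty (Fq : finFieldType) (R : realType) := MkCinfty {
  Cfield :> closedFieldType;
  Cemb : {rmorphism Fq -> Cfield};
  theta : Cfield;
  Cabs : Cfield -> R;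
  Cabs_ge0 : forall x, 0 <= Cabs x;
  Cabs_eq0 : forall x, Cabs x = 0 <-> x = 0;
  CabsM : forall x y, Cabs (x * y) = Cabs x * Cabs y;
  CabsD : forall x y, Cabs (x + y) <= Num.max (Cabs x) (Cabs y);
  Cabs_theta : Cabs theta = #|Fq|%:R;
  Ccomplete : forall u, cauchy_abs Cabs u -> exists l, cvg_abs Cabs u l;
  Calg_dense : forall x (e : R), 0 < e ->
    exists2 y, algebraic_Kinf Cemb theta Cabs y & Cabs (x - y) < e
}.

Arguments theta {Fq R} C : rename.
Arguments Cabs {Fq R} C : rename.
Arguments Cemb {Fq R} C : rename.

Section Frobenius.

Variables (Fq : finFieldType) (R : realType) (C : Cinfty Fq R).

Definition frob (x : C) : C := x ^+ #|Fq|.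

Lemma card_Fq_pnat : [pchar C].-nat #|Fq|.
Proof.
have [p p_pr pF] := finPcharP Fq.
have pC : p \in [pchar C] by rewrite -(fmorph_pchar (Cemb C)) in pF *.
rewrite (eq_pnat _ (pcharf_eq pC)).
have : (p.-abelem [set: Fq])%g by exact: fin_ring_pchar_abelem pF.
by move=> /abelem_pgroup; rewrite /pgroup cardsT.
Qed.

Lemma frob_zmod_morphism : zmod_morphism frob.
Proof.
move=> x y; apply: (addIr (frob y)).
by rewrite /frob -exprDn_pchar ?card_Fq_pnat // !subrK.
Qed.

Lemma frob_monoid_morphism : monoid_morphism frob.
Proof. by split=> [|x y]; rewrite /frob ?expr1n ?exprMn. Qed.

HB.instance Definition _ :=
  GRing.isZmodMorphism.Build C C frob frob_zmod_morphism.
HB.instance Definition _ :=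
  GRing.isMonoidMorphism.Build C C frob frob_monoid_morphism.

Lemma frob_inj : injective frob. Proof. exact: fmorph_inj. Qed.

Lemma frob_surj (x : C) : exists y : C, y ^+ #|Fq| == x.
Proof.
have q0 : (0 < #|Fq|)%N by apply/card_gt0P; exists 0.
have [y Dy] := @solve_monicpoly C #|Fq| (fun i => if i == 0 then x else 0) q0.
exists y; rewrite Dy (bigD1 (Ordinal q0)) //= expr0 mulr1 big1 ?addr0 //.
by move=> i; rewrite -val_eqE /= => /negPf ->; rewrite mul0r.
Qed.

(* c |-> c^(1/q); unique by frobK *)
Definition frobV (x : C) : C := xchoose (frob_surj x).

Lemma frobVK : cancel frobV frob.
Proof. by move=> x; apply/eqP; exact: (xchooseP (frob_surj x)). Qed.

Lemma frobK : cancel frob frobV.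
Proof. by move=> x; apply: frob_inj; rewrite frobVK. Qed.

Lemma frobV_zmod_morphism : zmod_morphism frobV.
Proof. by move=> x y; apply: frob_inj; rewrite frobVK rmorphB /= !frobVK. Qed.

Lemma frobV_monoid_morphism : monoid_morphism frobV.
Proof.
split=> [|x y]; apply: frob_inj.
  by rewrite frobVK rmorph1.
by rewrite frobVK rmorphM /= !frobVK.
Qed.

HB.instance Definition _ :=
  GRing.isZmodMorphism.Build C C frobV frobV_zmod_morphism.
HB.instance Definition _ :=
  GRing.isMonoidMorphism.Build C C frobV frobV_monoid_morphism.

(* c^(q^i) for i in Z *)
Definition twist (i : int) (c : C) : C :=
  match i with
  | Posz n => iter n frob c
  | Negz n => iter n.+1 frobV c
  end.

Definition Ctau : nzRingType := skewpoly frob.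
Definition Csigma : nzRingType := skewpoly frobV.

Definition tau_coef d (beta : 'M[Ctau]_d) (k : nat) : 'M[C]_d :=
  map_mx (fun f : Ctau => skew_coef f k) beta.

(* Entrywise form of beta^* = \sum_k (B_k^T)^(-k) sigma^k, where                *)
(* beta = \sum_k B_k tau^k and B_k = tau_coef beta k.                           *)
Definition skew_star (f : Ctau) : Csigma :=
  \poly_(k < size (f : {poly C})) twist (- k%:Z) (skew_coef f k).

Definition star d (beta : 'M[Ctau]_d) : 'M[Csigma]_d :=
  map_mx skew_star beta^T.

End Frobenius.

Section TModule.

Variables (Fq : finFieldType) (R : realType) (C : Cinfty Fq R).

Record tmodule (d : nat) := MkTModule {
  tm_phi :> {rmorphism {poly Fq} -> 'M[Ctau C]_d};
  tm_Fq_linear : forall a : Fq,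
    tm_phi a%:P = (skewC (@frob Fq R C) (Cemb C a))%:M;
  tm_nilpotent : exists n : nat,
    (tau_coef (tm_phi 'X) 0 - (theta C)%:M) ^+ n = 0
}.

Definition dual_motive (d : nat) (phi : tmodule d) : Type := 'rV[Csigma C]_d.

End TModule.

Section DualMotive.

Variables (Fq : finFieldType) (R : realType) (C : Cinfty Fq R).
Variables (d : nat) (phi : tmodule C d).

Definition tm_dt : 'M[C]_d := tau_coef (phi 'X) 0.

(* Coefficients of the composite P(Q(z)) of the F_q-linear series               *)
(* \sum_i P_i z^(i) and \sum_i Q_i z^(i).                                       *)
Definition Fq_lin_comp (P Q : nat -> 'M[C]_d) (n : nat) : 'M[C]_d :=
  \sum_(i < n.+1) P i *m map_mx (twist i%:Z) (Q (n - i)%N).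

Definition is_log (P : nat -> 'M[C]_d) : Prop :=
  P 0%N = 1%:M /\
  forall n, Fq_lin_comp P (tau_coef (phi 'X)) n = tm_dt *m P n.

Local Notation dual_motive := (dual_motive phi).

HB.instance Definition _ := GRing.Zmodule.copy dual_motive 'rV[Csigma C]_d.

Local Notation rowN := ('rV[Csigma C]_d).

Definition dm_C (c : C) (x : dual_motive) : dual_motive :=
  skewC (@frobV Fq R C) c *: (x : rowN).
Definition dm_sigma (x : dual_motive) : dual_motive :=
  (skewX (@frobV Fq R C) : Csigma C) *: (x : rowN).
Definition dm_t (x : dual_motive) : dual_motive :=
  (x : rowN) *m star (phi 'X).
Definition dm_std (k : 'I_d) : dual_motive := delta_mx 0 k : rowN.

(* t acts by dm_t, constants by dm_C: the C_oo[t]-module structure of N *)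
Definition dm_scale (a : {poly C}) (x : dual_motive) : dual_motive :=
  \sum_(k < size a) dm_C a`_k (iter k dm_t x).

Implicit Types (a b : {poly C}) (c : C) (x y : dual_motive).

Lemma dm_CDr c : {morph dm_C c : x y / x + y}.
Proof. by move=> x y; rewrite /dm_C scalerDr. Qed.

Lemma dm_CDl x : {morph dm_C^~ x : c c' / c + c'}.
Proof. by move=> c c'; rewrite /dm_C /skewC polyCD scalerDl. Qed.

Lemma dm_C0 x : dm_C 0 x = 0.
Proof. by rewrite /dm_C /skewC polyC0 scale0r. Qed.

Lemma dm_Cr0 c : dm_C c 0 = 0.
Proof. by rewrite /dm_C scaler0. Qed.

Lemma dm_C1 x : dm_C 1 x = x.
Proof. by rewrite /dm_C /skewC polyC1 scale1r. Qed.

Lemma dm_CM c c' x : dm_C c (dm_C c' x) = dm_C (c * c') x.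
Proof. by rewrite /dm_C scalerA skewCM. Qed.

Lemma dm_tD : {morph dm_t : x y / x + y}.
Proof. by move=> x y; rewrite /dm_t mulmxDl. Qed.

Lemma dm_t0 : dm_t 0 = 0.
Proof. by rewrite /dm_t mul0mx. Qed.

Lemma dm_tC c x : dm_t (dm_C c x) = dm_C c (dm_t x).
Proof. by rewrite /dm_t /dm_C scalemxAl. Qed.

Lemma iter_dm_tD k : {morph iter k dm_t : x y / x + y}.
Proof. by elim: k => [|k IH] x y //; rewrite !iterS IH dm_tD. Qed.

Lemma dm_scale_widen n a x : (size a <= n)%N ->
  dm_scale a x = \sum_(k < n) dm_C a`_k (iter k dm_t x).
Proof.
move=> le_an; rewrite /dm_scale.
rewrite (big_ord_widen n (fun k => dm_C a`_k (iter k dm_t x))) //.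
rewrite big_mkcond; apply: eq_bigr => k _; case: ltnP => // le_ak.
by rewrite nth_default // dm_C0.
Qed.

Lemma dm_scaleDl x : {morph dm_scale^~ x : a b / a + b}.
Proof.
move=> a b; set n := maxn (size a) (size b).
rewrite !(@dm_scale_widen n) ?leq_maxl ?leq_maxr ?size_polyD // -big_split /=.
by apply: eq_bigr => k _; rewrite coefD dm_CDl.
Qed.

Lemma dm_scaleDr : right_distributive dm_scale +%R.
Proof.
move=> a x y; rewrite /dm_scale -big_split /=.
by apply: eq_bigr => k _; rewrite iter_dm_tD dm_CDr.
Qed.

Lemma dm_scaleC c x : dm_scale c%:P x = dm_C c x.
Proof.
by rewrite (@dm_scale_widen 1) ?size_polyC_leq1 // big_ord1 /= coefC.
Qed.

Lemma dm_scale1 : left_id 1 dm_scale.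
Proof. by move=> x; rewrite dm_scaleC dm_C1. Qed.

Lemma dm_scaleMX a x : dm_scale (a * 'X) x = dm_scale a (dm_t x).
Proof.
rewrite (@dm_scale_widen (size a).+1); last first.
  by rewrite (leq_trans (size_polyMleq _ _)) // size_polyX addn2.
rewrite big_ord_recl coefMX /= dm_C0 add0r /dm_scale.
by apply: eq_bigr => k _; rewrite coefMX /= -iterSr.
Qed.

Lemma dm_scaleCM c a x : dm_scale (c%:P * a) x = dm_C c (dm_scale a x).
Proof.
rewrite (@dm_scale_widen (size a)) /dm_scale; last first.
  by rewrite mul_polyC size_scale_leq.
rewrite (big_morph _ (dm_CDr c) (dm_Cr0 c)).
by apply: eq_bigr => k _; rewrite coefCM dm_CM.
Qed.

Lemma dm_t_scale a x : dm_t (dm_scale a x) = dm_scale a (dm_t x).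
Proof.
rewrite /dm_scale (big_morph _ dm_tD dm_t0).
by apply: eq_bigr => k _; rewrite dm_tC -iterS iterSr.
Qed.

Lemma dm_scaleA a b x : dm_scale a (dm_scale b x) = dm_scale (a * b) x.
Proof.
elim/poly_ind: a x => [|a c IH] x.
  by rewrite mul0r /dm_scale size_poly0 !big_ord0.
rewrite mulrDl -mulrA ['X * b]mulrC mulrA !dm_scaleDl !dm_scaleMX dm_t_scale IH.
by rewrite dm_scaleC dm_scaleCM.
Qed.

HB.instance Definition _ := GRing.Zmodule_isLmodule.Build {poly C} dual_motive
  dm_scaleA dm_scale1 dm_scaleDr dm_scaleDl.

End DualMotive.

Definition is_basis (A : pzRingType) (V : lmodType A) (r : nat)
    (e : 'I_r -> V) : Prop :=
  forall x : V, exists! a : 'cV[A]_r, x = \sum_(j < r) a j 0 *: e j.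

Definition dual_motive_axiom (Fq : finFieldType) (R : realType)
    (C : Cinfty Fq R) (d : nat) (phi : tmodule C d) (r : nat) : Prop :=
  (exists e : 'I_r -> dual_motive phi, is_basis e) /\
  (exists n0 : nat, forall n, (n0 <= n)%N ->
    forall x : dual_motive phi, exists y : dual_motive phi,
      ('X - (theta C)%:P) ^+ n *: x = dm_sigma y).

(* Main.v *)
Require Import Defs.
From HB Require Import structures.
From mathcomp Require Import all_boot all_order all_algebra all_fingroup.
From mathcomp Require Import all_solvable all_field.
From mathcomp Require Import reals zify.

(* Write D for d[t]. For x = \sum_k x_k sigma^k in N and m >= 0 put
     L_m(x) = \sum_(i + k = m) P_i (x_k^T)^(m).
   The functional equation of Log_phi says that L_m(f x) = f^(m)(D) L_m(x) for
   f in C_oo[t]; moreover L_(m+1)(sigma x) = L_m(x), L_0(sigma x) = 0, and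
   L_m(s_k) is the k-th column of P_m. Let V_j be the C_oo[D]-module generated
   by the L_m(e_i), i <= j. The triangular shape of Phi, together with the
   invertibility of D - theta^(q^m) for m >= 1, shows that V_j does not depend
   on m, and the case m = 0 shows that (D - theta)^(l_j) V_j is in V_(j-1).
   Hence V_j / V_(j-1) is spanned by the (D - theta^(q^m))^a L_m(e_j) with
   a < l_j. These are columns of P_m, so the columns of P_m span V_r, which is
   the whole space since L_0 is onto. *)

Set Implicit Arguments.
Unset Strict Implicit.
Unset Printing Implicit Defensive.

Import Order.TTheory GRing.Theory Num.Theory.
Local Open Scope ring_scope.

(** * Submodules for the action of polynomials in a square matrix *)

Section PolynomialAction.

Variables (F : fieldType) (d : nat) (D : 'M[F]_d.+1).

Implicit Types (p q : {poly F}) (x y : 'cV[F]_d.+1).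

Definition pact p x : 'cV[F]_d.+1 := horner_mx D p *m x.

Lemma pactDl p q x : pact (p + q) x = pact p x + pact q x.
Proof. by rewrite /pact rmorphD mulmxDl. Qed.

Lemma pactDr p x y : pact p (x + y) = pact p x + pact p y.
Proof. by rewrite /pact mulmxDr. Qed.

Lemma pact0 p : pact p 0 = 0.
Proof. by rewrite /pact mulmx0. Qed.

Lemma pactM p q x : pact (p * q) x = pact p (pact q x).
Proof. by rewrite /pact rmorphM mulmxA. Qed.

Lemma pactC c x : pact c%:P x = c *: x.
Proof. by rewrite /pact horner_mx_C mul_scalar_mx. Qed.

Lemma pact1 x : pact 1 x = x.
Proof. by rewrite pactC scale1r. Qed.

Lemma pactN p x : pact (- p) x = - pact p x.
Proof. by rewrite /pact rmorphN mulNmx. Qed.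

Variable r : nat.
Implicit Types (v w : 'I_r -> 'cV[F]_d.+1) (i j : 'I_r).

(** The $F[D]$-submodule generated by the first [n] vectors, as an inductive predicate so that
    inclusions follow by induction on membership. *)
Inductive polyspan v n : 'cV[F]_d.+1 -> Prop :=
| polyspan_gen i : (i < n)%N -> polyspan v n (v i)
| polyspan0 : polyspan v n 0
| polyspanD x y : polyspan v n x -> polyspan v n y -> polyspan v n (x + y)
| polyspan_act p x : polyspan v n x -> polyspan v n (pact p x).

Lemma polyspan_sum v n I (s : seq I) (T : pred I) (f : I -> 'cV[F]_d.+1) :
  (forall i : I, T i -> polyspan v n (f i)) ->
  polyspan v n (\sum_(i <- s | T i) f i).
Proof.
by move=> H; apply: big_ind => //; [exact: polyspan0|exact: polyspanD].
Qed.

Lemma polyspanN v n x : polyspan v n x -> polyspan v n (- x).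
Proof. by move=> /(polyspan_act (-1)); rewrite pactN pact1. Qed.

Lemma polyspan_sub v w n x : (forall i, (i < n)%N -> polyspan w n (v i)) ->
  polyspan v n x -> polyspan w n x.
Proof.
move=> H; elim=> *; [exact: H|exact: polyspan0|exact: polyspanD|].
exact: polyspan_act.
Qed.

Lemma polyspan_mono v m n x : (m <= n)%N -> polyspan v m x -> polyspan v n x.
Proof.
move=> mn; elim=> *; [|exact: polyspan0|exact: polyspanD|exact: polyspan_act].
by apply: polyspan_gen; apply: leq_trans mn.
Qed.

Lemma polyspan_last v j x : polyspan v j.+1 x ->
  exists p y, polyspan v j y /\ x = pact p (v j) + y.
Proof.
elim=> [i|||p {}x _ [p1 [y1 [H1 ->]]]].
- rewrite ltnS leq_eqVlt => /orP[/eqP/val_inj ->|ij].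
    by exists 1, 0; rewrite pact1 addr0; split=> //; exact: polyspan0.
  exists 0, (v i); rewrite pactC scale0r add0r; split=> //.
  exact: polyspan_gen.
- by exists 0, 0; rewrite pactC scale0r addr0; split=> //; exact: polyspan0.
- move=> x1 x2 _ [p1 [y1 [H1 ->]]] _ [p2 [y2 [H2 ->]]].
  exists (p1 + p2), (y1 + y2); split; first exact: polyspanD.
  by rewrite pactDl addrACA.
exists (p * p1), (pact p y1); split; first exact: polyspan_act.
by rewrite pactDr pactM.
Qed.

(** Isolate the diagonal term: entries below it vanish, and entries above it only involve generators
    of smaller index. It serves both with [z] a vector of a second family and with [z = 0]. *)
Lemma polyspan_triangular v (Q : 'M[{poly F}]_r) k j z :
  (forall i j, (j < i)%N -> Q i j = 0) ->
  Q j j \is a GRing.unit ->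
  z = \sum_i pact (Q i j * k) (v i) ->
  exists2 y, polyspan v j y & pact k (v j) = pact (Q j j)^-1 z + y.
Proof.
move=> Qtrig Qu zE.
exists (- pact (Q j j)^-1 (\sum_(i | i != j) pact (Q i j * k) (v i))).
  apply/polyspanN/polyspan_act/polyspan_sum => i ij.
  have [ltij|] := ltnP i j; first exact/polyspan_act/polyspan_gen.
  rewrite leq_eqVlt val_eqE eq_sym (negPf ij) /= => /Qtrig ->.
  by rewrite mul0r pactC scale0r; exact: polyspan0.
by rewrite zE (bigD1 j) //= pactDr addrK -pactM mulKr.
Qed.

(* By repeated division by X - c. *)
Lemma pact_span (S : 'cV[F]_d.+1 -> Prop) c n p x :
  S 0 -> (forall y z, S y -> S z -> S (y + z)) ->
  (forall a y, S y -> S (a *: y)) ->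
  (forall a, (a < n)%N -> S (pact (('X - c%:P) ^+ a) x)) ->
  (size p <= n)%N -> S (pact p x).
Proof.
move=> S0 SD SZ; elim: n p x => [|n IH] p x Sx.
  by rewrite leqn0 size_poly_eq0 => /eqP ->; rewrite pactC scale0r.
move=> sp; rewrite (divp_eq p ('X - c%:P)) modp_XsubC pactDl pactM pactC.
apply: (SD); last by apply: SZ; have := Sx 0%N isT; rewrite expr0 pact1.
apply: IH => [a an|]; first by rewrite -pactM -exprSr; apply: Sx.
by rewrite size_divp ?polyXsubC_eq0 // size_XsubC leq_subLR.
Qed.

Variables (th : F).
Hypothesis D_nilp : exists n, (D - th%:M) ^+ n = 0.

(** Some power of ['X - th%:P] annihilates everything and is coprime to [('X - c%:P) ^+ l]; a Bezout
    coefficient is the inverse. *)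
Lemma pact_XsubC_inv c l : c != th ->
  exists p, forall x, pact p (pact (('X - c%:P) ^+ l) x) = x.
Proof.
move=> cth; have [n Dn] := D_nilp.
have cop : coprimep (('X - c%:P) ^+ l) (('X - th%:P) ^+ n).
  apply/coprimep_expl/coprimep_expr.
  by rewrite coprimep_XsubC root_XsubC eq_sym.
have /Bezout_eq1_coprimepP[[u1 u2] /= E] := cop.
have ann x : pact (('X - th%:P) ^+ n) x = 0.
  by rewrite /pact rmorphXn rmorphB /= horner_mx_X horner_mx_C Dn mul0mx.
exists u1 => x; rewrite -[RHS]pact1 -E pactDl [in RHS]pactM.
by rewrite [X in _ = _ + X]pactM ann pact0 addr0.
Qed.

Lemma polyspan_twist v w (Q : 'M[{poly F}]_r) (ell : 'I_r -> nat) c n x :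
  (forall i j, (j < i)%N -> Q i j = 0) ->
  (forall j, Q j j \is a GRing.unit) -> c != th ->
  (forall j, w j = \sum_i pact (Q i j * ('X - c%:P) ^+ ell j) (v i)) ->
  polyspan w n x <-> polyspan v n x.
Proof.
move=> Qtrig Qu cth wE; split; apply: polyspan_sub => i ltin.
  rewrite wE; apply: polyspan_sum => k _.
  have [leki|/Qtrig ->] := leqP k i.
    by apply/polyspan_act/polyspan_gen/(leq_ltn_trans leki).
  by rewrite mul0r pactC scale0r; exact: polyspan0.
apply: (@polyspan_mono w i.+1) => //.
(* Strong induction puts [v i] in the span of the [w k] with [k <= i]: the relation for [w i] is
   solved for [v i] once the power of ['X - c%:P] is inverted. *)
have [m] := ubnP (i : nat); elim: m i {ltin} => // m IH i lt_im.
have [y Hy] := polyspan_triangular Qtrig (Qu i) (wE i).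
have [p pK] := pact_XsubC_inv (ell i) cth.
move=> /(congr1 (pact p)); rewrite pK => ->; apply: polyspan_act.
apply: polyspanD; first exact/polyspan_act/polyspan_gen.
apply: (polyspan_mono (leqnSn i)); move: Hy; apply: polyspan_sub => k ltki.
by apply: (@polyspan_mono w k.+1) => //; apply/IH/(leq_trans ltki).
Qed.

(** Each quotient of the filtration is killed by a power of $D - th$, so remainders modulo that
    power suffice; [pact_span] expands them around the other point [c]. [S] is a linear subspace,
    not assumed stable under [D]. *)
Lemma polyspan_sub_span (S : 'cV[F]_d.+1 -> Prop) v (ell : 'I_r -> nat) c n x :
  S 0 -> (forall y z, S y -> S z -> S (y + z)) ->
  (forall a y, S y -> S (a *: y)) ->
  (forall j, polyspan v j (pact (('X - th%:P) ^+ ell j) (v j))) ->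
  (forall j a, (a < ell j)%N -> S (pact (('X - c%:P) ^+ a) (v j))) ->
  (n <= r)%N -> polyspan v n x -> S x.
Proof.
move=> S0 SD SZ vker Sv; elim: n x => [|n IH] x ltnr.
  suff: polyspan v 0 x -> x = 0 by move=> H /H ->.
  by elim=> // [y z _ -> _ ->|p y _ ->]; rewrite ?addr0 ?pact0.
move=> /(@polyspan_last v (Ordinal ltnr))[p [y [Hy ->]]].
apply: (SD); last exact: (IH _ (ltnW ltnr)).
set j := Ordinal ltnr; rewrite (divp_eq p (('X - th%:P) ^+ ell j)) pactDl.
apply: (SD).
  by rewrite pactM; apply/(IH _ (ltnW ltnr))/polyspan_act/(vker j).
apply: (pact_span S0 SD SZ (Sv j)).
by rewrite -ltnS -(size_exp_XsubC (ell j) th) ltn_modp expf_neq0 ?polyXsubC_eq0.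
Qed.

End PolynomialAction.

(** * Iterated Frobenius and its effect on [theta] *)

Section IteratedFrobenius.

Variables (Fq : finFieldType) (R : realType) (C : Cinfty Fq R).

Definition frobn (n : nat) (x : C) : C := iter n (@frob Fq R C) x.

Lemma frobn_zmod_morphism n : zmod_morphism (frobn n).
Proof.
by rewrite /frobn; elim: n => // n IH x y; rewrite !iterS IH rmorphB.
Qed.

Lemma frobn_monoid_morphism n : monoid_morphism (frobn n).
Proof.
rewrite /frobn; elim: n => // n [IH1 IHM].
by split=> [|x y]; rewrite !iterS ?IH1 ?IHM ?rmorph1 ?rmorphM.
Qed.

HB.instance Definition _ n :=
  GRing.isZmodMorphism.Build C C (frobn n) (frobn_zmod_morphism n).
HB.instance Definition _ n :=
  GRing.isMonoidMorphism.Build C C (frobn n) (frobn_monoid_morphism n).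

Lemma twistN n (x : C) : twist (- n%:Z) x = iter n (@frobV Fq R C) x.
Proof. by case: n. Qed.

Lemma frobn_iter_frobV m a (x : C) : (a <= m)%N ->
  frobn m (iter a (@frobV Fq R C) x) = frobn (m - a) x.
Proof.
rewrite /frobn; elim: a m => [|a IH] [|m] // am.
by rewrite [in LHS]iterSr [iter a.+1 _ _]iterS frobVK subSS IH.
Qed.

(** As $|\theta| = q > 1$, every application of Frobenius strictly increases the absolute value. *)
Lemma frobn_theta_neq n : frobn n.+1 (theta C) != theta C.
Proof.
have q1 : (1 < #|Fq|)%N by apply: finNzRing_gt1.
have abs1 : Cabs C 1 = 1.
  have /mulIf : Cabs C 1 != 0.
    by apply/eqP => /Cabs_eq0/eqP; rewrite oner_eq0.
  by apply; rewrite -CabsM !mul1r.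
have absX x k : Cabs C (x ^+ k) = Cabs C x ^+ k.
  by elim: k => [|k IH]; rewrite ?expr0 // !exprS CabsM IH.
have abs_gt x : 1 < Cabs C x -> Cabs C x < Cabs C (frob x).
  by move=> x1; rewrite /frob absX -[ltLHS]expr1 ltr_eXn2l.
suff : 1 < Cabs C (frobn n (theta C)) /\
       Cabs C (theta C) <= Cabs C (frobn n (theta C)).
  case=> lt1 le1; apply/eqP => E.
  have := le_lt_trans le1 (abs_gt _ lt1).
  by rewrite -[frob _]/(frobn n.+1 _) E ltxx.
elim: n => [|n [lt1 le1]]; first by rewrite Cabs_theta ltr1n lexx.
have lt2 := abs_gt _ lt1.
by split; [exact: lt_trans lt2 | exact: le_trans (ltW lt2)].
Qed.

End IteratedFrobenius.

(** * Semilinear components of the logarithm on the dual $t$-motive *)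

Section LogFunctionals.

Variables (Fq : finFieldType) (R : realType) (C : Cinfty Fq R).
Variables (d : nat) (phi : tmodule C d.+1).
Variables (P : nat -> 'M[C]_d.+1) (HP : is_log phi P).

Local Notation D := (tm_dt phi).
Implicit Types x y : dual_motive phi.

Definition tcoef m k x : 'cV[C]_d.+1 :=
  \col_j frobn m (skew_coef ((x : 'rV[Csigma C]_d.+1) 0 j) k).

(* With delta_1 (\sum_k n_k sigma^k) = \sum_k n_k^(k), this is the part of
   Log_phi (delta_1 x) that is q^m-Frobenius semilinear in x. *)
Definition logpart m x : 'cV[C]_d.+1 :=
  \sum_(k < m.+1) P (m - k) *m tcoef m k x.

Lemma logpartD m : {morph logpart m : x y / x + y}.
Proof.
move=> x y; rewrite -big_split /=; apply: eq_bigr => k _.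
rewrite -mulmxDr; congr (_ *m _); apply/colP => j.
by rewrite !mxE /skew_coef coefD rmorphD.
Qed.

Lemma logpart0 m : logpart m 0 = 0.
Proof. by apply: (addIr (logpart m 0)); rewrite -logpartD !add0r. Qed.

Lemma logpart_C m c x : logpart m (dm_C c x) = frobn m c *: logpart m x.
Proof.
rewrite scaler_sumr; apply: eq_bigr => k _.
rewrite scalemxAr; congr (_ *m _); apply/colP => j; rewrite !mxE /skew_coef.
rewrite [X in frobn m X]coef_skew_mul big_ord_recl big1 => [|i _].
  by rewrite coefC subn0 addr0 rmorphM.
by rewrite coefC mul0r.
Qed.

(** [sigma] shifts coefficients by one and extracts $q$-th roots, which the extra Frobenius of level
    [m.+1] undoes. *)
Lemma logpart_sigmaS m x : logpart m.+1 (dm_sigma x) = logpart m x.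
Proof.
have X0 j k : skew_coef ((dm_sigma x : 'rV[Csigma C]_d.+1) 0 j) k =
    if k is k'.+1 then frobV (skew_coef ((x : 'rV[Csigma C]_d.+1) 0 j) k')
    else 0.
  rewrite !mxE /skew_coef [LHS]coef_skew_mul /skewX.
  case: k => [|k]; first by rewrite big_ord1 coefX mul0r.
  rewrite 2!big_ord_recl coefX mul0r add0r coefX mul1r /= subn1.
  by rewrite big1 ?addr0 // => i _; rewrite coefX mul0r.
rewrite /logpart big_ord_recl.
have -> : tcoef m.+1 (@ord0 m.+1) (dm_sigma x) = 0.
  by apply/colP => j; rewrite [LHS]mxE X0 rmorph0 mxE.
rewrite mulmx0 add0r; apply: eq_bigr => k _.
rewrite lift0 subSS; congr (_ *m _); apply/colP => j.
by rewrite [LHS]mxE [RHS]mxE X0 /frobn iterSr frobVK.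
Qed.

Lemma logpart0_sigma x : logpart 0 (dm_sigma x) = 0.
Proof.
rewrite /logpart big_ord1; apply/colP => j; rewrite !mxE big1 // => i _.
rewrite !mxE /skew_coef [X in frobn _ X]coef_skew_mul big_ord1.
by rewrite /skewX coefX mul0r rmorph0 mulr0.
Qed.

(** Moving $\sigma^a$ past $(B_{k-a}^\top)^{(a-k)}$ gives the twist $-k$; the outer twist by [m]
    turns it into [m - k], nonnegative since [k <= m]. *)
Lemma tcoef_t m k x : (k <= m)%N ->
  tcoef m k (dm_t x) = \sum_(a < k.+1)
    map_mx (twist (m - k)%:Z) (tau_coef (phi 'X) (k - a)) *m tcoef m a x.
Proof.
move=> km; apply/colP => i; rewrite !mxE /skew_coef summxE.
rewrite coef_sum rmorph_sum /=.
transitivity (\sum_(j < d.+1) \sum_(a < k.+1)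
    frobn (m - k) (skew_coef (phi 'X i j) (k - a)) *
    frobn m (skew_coef ((x : 'rV[Csigma C]_d.+1) 0 j) a)).
  apply: eq_bigr => j _; rewrite [X in frobn m X]coef_skew_mul rmorph_sum.
  apply: eq_bigr => a _; rewrite rmorphM mulrC; congr (_ * _) => //.
  have ak : (a <= k)%N by rewrite -ltnS.
  rewrite [LHS]frobn_iter_frobV ?(leq_trans ak) // !mxE coef_poly.
  case: ltnP => H.
    by rewrite twistN frobn_iter_frobV; [congr frobn|]; lia.
  by rewrite /skew_coef nth_default // !rmorph0.
rewrite exchange_big /=; apply: eq_bigr => a _; rewrite !mxE.
by apply: eq_bigr => j _; rewrite !mxE.
Qed.

Lemma logpart_t m x : logpart m (dm_t x) = D *m logpart m x.
Proof.
rewrite mulmx_sumr /logpart.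
pose G k a := P (m - k) *m
  (map_mx (twist (m - k)%:Z) (tau_coef (phi 'X) (k - a)) *m tcoef m a x).
transitivity (\sum_(k < m.+1) \sum_(a < m.+1 | (a <= k)%N) G k a).
  apply: eq_bigr => k _; have km : (k <= m)%N by rewrite -ltnS.
  rewrite tcoef_t // mulmx_sumr (big_ord_narrow_leq (n1 := k) km) /=.
  by apply: eq_bigr.
rewrite (exchange_big_dep predT) //=; apply: eq_bigr => a _.
have am : (a <= m)%N by rewrite -ltnS.
(* For fixed [a], up to the factor [tcoef m a x], the sum over [k] is the coefficient of index
   [m - a] of $\mathrm{Log}_\phi(\phi_t(z))$, summed in reverse order. *)
rewrite mulmxA -(HP.2 (m - a)%N) mulmx_suml.
rewrite (reindex_inj rev_ord_inj) /=.
transitivity (\sum_(i < m.+1 | (i <= m - a)%N) G (m - i)%N a).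
  by apply: eq_big => [i|i _]; rewrite subSS //; have := ltn_ord i; lia.
rewrite (big_ord_narrow_leq (leq_subr a m)) /=; apply: eq_bigr => i _.
have im := ltn_ord i.
by rewrite /G mulmxA subKn ?(subnAC m i a) //; lia.
Qed.

(** The variable $t$ acts through [D] at every level while constants are twisted, so $t-\theta$
    becomes $D-\theta^{q^m}$. *)
Lemma logpart_scale m (f : {poly C}) x :
  logpart m (f *: x) = pact D (map_poly (frobn m) f) (logpart m x).
Proof.
rewrite /GRing.scale /= /dm_scale (big_morph _ (logpartD m) (logpart0 m)).
rewrite /pact /map_poly poly_def rmorph_sum /= mulmx_suml.
apply: eq_bigr => k _; rewrite logpart_C linearZ /= rmorphXn /= horner_mx_X.
rewrite -scalemxAl; congr (_ *: _).
elim: (k : nat) => [|n IH]; first by rewrite expr0 mul1mx.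
by rewrite iterS logpart_t IH exprS mulmxA.
Qed.

Lemma logpart_sum m I (s : seq I) (T : pred I) (f : I -> dual_motive phi) :
  logpart m (\sum_(i <- s | T i) f i) = \sum_(i <- s | T i) logpart m (f i).
Proof. exact: (big_morph _ (logpartD m) (logpart0 m)). Qed.

Lemma logpart_std m (k : 'I_d.+1) : logpart m (dm_std phi k) = col k (P m).
Proof.
have tc n : tcoef m n (dm_std phi k) = (n == 0)%:R *: delta_mx k 0.
  apply/colP => j; rewrite !mxE /skew_coef eqxx andbT eq_sym.
  case: (k == j); rewrite ?mulr1 ?mulr0 /=; last by rewrite coef0 rmorph0.
  by rewrite [X in frobn m X]coef1 rmorph_nat.
rewrite /logpart big_ord_recl big1 => [|i _]; rewrite tc ?scale0r ?mulmx0 //.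
by rewrite scale1r addr0 subn0 colE.
Qed.

Lemma logpart0_surj (y : 'cV[C]_d.+1) : exists x, logpart 0 x = y.
Proof.
exists (\row_j skewC (@frobV Fq R C) (y j 0)).
rewrite /logpart big_ord1 HP.1 mul1mx; apply/colP => j.
by rewrite !mxE /skew_coef coefC.
Qed.

End LogFunctionals.

(** * Invertibility of the coefficients of the logarithm *)

Lemma upper_trig_unitmx_diag (A : comUnitRingType) r (M : 'M[A]_r) j :
  (forall i j : 'I_r, (j < i)%N -> M i j = 0) -> M \in unitmx ->
  M j j \is a GRing.unit.
Proof.
move=> Mtrig; rewrite unitmxE -det_tr det_trig; last first.
  by apply/is_trig_mxP => i k ltik; rewrite mxE Mtrig.
by rewrite (bigD1 j) //= unitrM mxE => /andP[].
Qed.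

Theorem theorem4p7 (Fq : finFieldType) (R : realType) (C : Cinfty Fq R)
  (d r : nat) (phi : tmodule C d) (HN : dual_motive_axiom phi r)
  (e : 'I_r -> dual_motive phi) (He : is_basis e)
  (ell : 'I_r -> nat) (Hell : (\sum_(i < r) ell i = d)%N)
  (M : 'M[{poly C}]_r) (HMunit : M \in unitmx)
  (HMtrig : forall i j : 'I_r, (j < i)%N -> M i j = 0)
  (Hsigma : forall a : 'cV[{poly C}]_r,
    let Phi := M *m diag_mx (\row_(j < r) ('X - (theta C)%:P) ^+ ell j) in
    let b := Phi *m map_mx (map_poly (@twist Fq R C (-1))) a in
    dm_sigma (\sum_(j < r) a j 0 *: e j) = \sum_(j < r) b j 0 *: e j)
  (Hstd : forall (i : 'I_r) (j : nat) (k : 'I_d),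
    (1 <= j <= ell i)%N ->
    (k.+1 = \sum_(m < r | (m <= i)%N) ell m - j + 1)%N ->
    ('X - (theta C)%:P) ^+ (j - 1) *: e i = dm_std phi k)
  (P : nat -> 'M[C]_d) (HP : is_log phi P) :
  forall i : nat, P i \in unitmx.
Proof.
move=> m.
(* Polynomials in [D] are set up in positive dimension only, so [d = 0] is treated apart. *)
case: d phi {HN} e He Hell Hsigma Hstd P HP => [|d] phi e He Hell Hsigma Hstd.
  by move=> P _; rewrite unitmxE det_mx00 unitr1.
move=> P HP.
pose D := tm_dt phi; pose w n i := logpart P n (e i).
pose Mn n := map_mx (map_poly (@frobn Fq R C n)) M.
pose th n := frobn n (theta C).
have Mn_trig n (i j : 'I_r) : (j < i)%N -> Mn n i j = 0.
  by move=> ji; rewrite mxE HMtrig ?rmorph0.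
have Mn_unit n j : Mn n j j \is a GRing.unit.
  by rewrite mxE rmorph_unit // upper_trig_unitmx_diag.
have sigma_e j :
    dm_sigma (e j) = \sum_i (M i j * ('X - (theta C)%:P) ^+ ell j) *: e i.
  have := Hsigma (delta_mx j 0).
  rewrite (bigD1 j) //= big1 => [|i /negPf ij]; last by rewrite mxE ij scale0r.
  rewrite mxE !eqxx scale1r addr0 => ->; apply: eq_bigr => i _.
  (* [twist (-1)] computes to [frobV], whose morphism structure shows that the unit vector is
     fixed. *)
  rewrite -[map_mx _ _]/(map_mx (map_poly (@frobV Fq R C)) (delta_mx j 0)).
  by rewrite map_delta_mx -colE mul_mx_diag !mxE.
have w_sigma n j : logpart P n (dm_sigma (e j)) =
    \sum_i pact D (Mn n i j * ('X - (th n)%:P) ^+ ell j) (w n i).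
  rewrite sigma_e logpart_sum; apply: eq_bigr => i _.
  rewrite (logpart_scale HP) rmorphM rmorphXn rmorphB /= map_polyX map_polyC.
  by rewrite mxE.
(* The relation $L_{n+1}(\sigma e_j)=L_n(e_j)$ expresses [w n] triangularly in [w n.+1], with
   $\theta^{q^{n+1}}\ne\theta$. *)
have span_w n k y : polyspan D (w 0) k y <-> polyspan D (w n) k y.
  elim: n => // n IH; rewrite IH.
  apply: (@polyspan_twist _ _ _ _ _ (tm_nilpotent phi)
    _ _ (Mn n.+1) ell (th n.+1)).
  - exact: Mn_trig.
  - exact: Mn_unit.
  - exact: frobn_theta_neq.
  by move=> j; rewrite -w_sigma logpart_sigmaS.
have w0_kill (j : 'I_r) : polyspan D (w 0) j
    (pact D (('X - (theta C)%:P) ^+ ell j) (w 0 j)).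
  (* At level 0, [th 0] is [theta] itself and the triangular relation has left side 0. *)
  have E : 0 = \sum_i pact D (Mn 0 i j * ('X - (th 0)%:P) ^+ ell j) (w 0 i).
    by rewrite -w_sigma logpart0_sigma.
  have [y Hy ->] := polyspan_triangular (@Mn_trig 0) (Mn_unit 0 j) E.
  by rewrite pact0 add0r.
have w_kill n (j : 'I_r) : polyspan D (w n) j
    (pact D (('X - (theta C)%:P) ^+ ell j) (w n j)).
  apply/span_w.
  (* Modulo the smaller submodule, [w n j] is a polynomial multiple of [w 0 j], so it inherits the
     annihilator. *)
  have /span_w : polyspan D (w n) j.+1 (w n j) by exact: polyspan_gen.
  case/polyspan_last => p [y [Hy ->]]; rewrite pactDr.
  apply: polyspanD; last exact: polyspan_act.
  by rewrite -pactM mulrC pactM; apply: polyspan_act.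
have span_all n y : polyspan D (w n) r y.
  apply/span_w; have [x <-] := logpart0_surj HP y.
  have [a [-> _]] := He x; rewrite logpart_sum; apply: polyspan_sum => i _.
  by rewrite (logpart_scale HP); apply/polyspan_act/polyspan_gen.
have cols j a : (a < ell j)%N ->
    exists z, pact D (('X - (th m)%:P) ^+ a) (w m j) = P m *m z.
  move=> lta; pose s := (\sum_(i < r | (i <= j)%N) ell i)%N.
  have ls : (ell j <= s)%N by rewrite /s (bigD1 j) //= leq_addr.
  have sd : (s <= d.+1)%N.
    rewrite -Hell /s [X in (_ <= X)%N](bigID (fun i : 'I_r => (i <= j)%N)) /=.
    exact: leq_addr.
  (* [Hstd] counts from 1, so its [j] is [a.+1] and the 0-based column is [s - a.+1]; nothing is
     truncated because [a < ell j <= s]. *)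
  have kd : (s - a.+1 < d.+1)%N by lia.
  have := Hstd j a.+1 (Ordinal kd); rewrite /= lta subSS subn0 => H.
  have {}H : ('X - (theta C)%:P) ^+ a *: e j = dm_std phi (Ordinal kd).
    by apply: H => //; rewrite -/s; lia.
  exists (delta_mx (Ordinal kd) 0); rewrite -colE -(logpart_std phi) -H.
  by rewrite (logpart_scale HP) rmorphXn rmorphB /= map_polyX map_polyC.
have onto (y : 'cV[C]_d.+1) : exists z, y = P m *m z.
  apply: (polyspan_sub_span (S := fun y => exists z, y = P m *m z)
    _ _ _ (w_kill m) cols (leqnn r) (span_all m y)).
  - by exists 0; rewrite mulmx0.
  - by move=> _ _ [z1 ->] [z2 ->]; exists (z1 + z2); rewrite mulmxDr.
  - by move=> a _ [z ->]; exists (a *: z); rewrite scalemxAr.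
(* Matrix subspaces are row spaces, so surjectivity on columns is read on the transpose. *)
rewrite -unitmx_tr -row_full_unit -sub1mx; apply/row_subP => i.
have [z Hz] := onto (row i 1%:M)^T.
by apply/submxP; exists z^T; rewrite -trmx_mul -Hz trmxK.
Qed.
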